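(* For every $d\ge3$, \[\operatorname{cr}_2(d)=d-\lfloor\log_2(d)\rfloor-1.\]
   Context: A lattice simplex in $\mathbb{R}^d$ is the convex hull of $d+1$ affinely independent points of $\mathbb{Z}^d$; it is empty if its only lattice points are its vertices. After translating a vertex to the origin, write $\Delta=AS_d$ with $S_d=\operatorname{conv}\{\mathbf{0},e_1,\ldots,e_d\}$, $A\in\mathbb{Z}^{d\times d}$ invertible; $G_\Delta=\mathbb{Z}^d/A\mathbb{Z}^d$, and $\operatorname{cr}(\Delta)$ is the number of elementary divisors of $A$ larger than $1$. For a prime $p$, a $p$-power simplex is a lattice simplex with $G_\Delta\cong(\mathbb{Z}_p)^s$ for some $s\ge0$, and $\operatorname{cr}_p(d)$ is the maximum of $\operatorname{cr}(\Delta)$ over all empty $p$-power simplices $\Delta\subseteq\mathbb{R}^d$. *)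

(* Defs.v *)
From HB Require Import structures.
From mathcomp Require Import all_boot all_order all_algebra.
From mathcomp Require Import boolp classical_sets reals.

Set Implicit Arguments.
Unset Strict Implicit.
Unset Printing Implicit Defensive.

Import Order.TTheory GRing.Theory Num.Theory.
Local Open Scope ring_scope.
Local Open Scope classical_set_scope.

Definition real_point (R : realType) (d : nat) (z : 'cV[int]_d) : 'cV[R]_d :=
  map_mx intr z.

Definition affinely_independent (R : realType) (d n : nat)
    (v : 'I_n -> 'cV[R]_d) : Prop :=
  forall a : 'I_n -> R,
    \sum_i a i = 0 -> \sum_i a i *: v i = 0 -> forall i, a i = 0.

Definition conv (R : realType) (d n : nat) (v : 'I_n -> 'cV[R]_d) :
    set 'cV[R]_d :=
  [set x | exists a : 'I_n -> R,
     [/\ forall i, 0 <= a i, \sum_i a i = 1 & x = \sum_i a i *: v i]].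

(* A lattice simplex is given by an enumeration of its vertices. *)
Definition lattice_simplex (R : realType) (d : nat)
    (v : 'I_d.+1 -> 'cV[int]_d) : Prop :=
  affinely_independent (fun i => real_point R (v i)).

Definition simplex_set (R : realType) (d : nat)
    (v : 'I_d.+1 -> 'cV[int]_d) : set 'cV[R]_d :=
  conv (fun i => real_point R (v i)).

Definition empty_simplex (R : realType) (d : nat)
    (v : 'I_d.+1 -> 'cV[int]_d) : Prop :=
  forall z : 'cV[int]_d, simplex_set v (real_point R z) -> exists i, z = v i.

(* After the translation taking v 0 to the origin, the simplex is A S_d. *)
Definition simplex_mx (d : nat) (v : 'I_d.+1 -> 'cV[int]_d) : 'M[int]_d :=
  \matrix_(i, j) (v (lift ord0 j) - v ord0) i 0.

Section ImageLattice.
Variables (d : nat) (A : 'M[int]_d).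

Definition image_lattice : {pred 'cV[int]_d} :=
  fun x => `[< exists y : 'cV[int]_d, x = A *m y >].

Lemma image_lattice_zmod_closed : zmod_closed image_lattice.
Proof.
split=> [|x y /asboolP[u ->] /asboolP[w ->]].
  by apply/asboolP; exists 0; rewrite mulmx0.
by apply/asboolP; exists (u - w); rewrite mulmxBr.
Qed.

HB.instance Definition _ :=
  GRing.isZmodClosed.Build 'cV[int]_d image_lattice image_lattice_zmod_closed.

End ImageLattice.

Definition simplex_group (d : nat) (v : 'I_d.+1 -> 'cV[int]_d) : zmodType :=
  Quotient.quot (image_lattice (simplex_mx v)).

(* The library's Smith normal form fixes the diagonal only up to signs; the
   absolute values do not depend on the chosen form. *)
Definition elementary_divisors (d : nat) (A : 'M[int]_d) : seq nat :=
  let: existT2 _ _ (existT2 _ _ (exist2 s _ _)) := int_Smith_normal_form A in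
  [seq absz s`_i | i <- iota 0 d].

Definition cr (d : nat) (v : 'I_d.+1 -> 'cV[int]_d) : nat :=
  count (fun e => 1 < e)%N (elementary_divisors (simplex_mx v)).

(* To be used with p prime, since 'Z_p is the ring Z/pZ only for p > 1. *)
Definition p_power_simplex (p d : nat) (v : 'I_d.+1 -> 'cV[int]_d) : Prop :=
  exists (s : nat) (f : {additive simplex_group v -> 'rV['Z_p]_s}),
    bijective f.

Definition cr_value (R : realType) (p d k : nat) : Prop :=
  exists v : 'I_d.+1 -> 'cV[int]_d,
    [/\ lattice_simplex R v, empty_simplex R v, p_power_simplex p v
      & cr v = k].

(* The maximum of cr; the range k <= d loses nothing, see crpP. *)
Definition crp (R : realType) (p d : nat) : nat :=
  \max_(k < d.+1 | `[< cr_value R p d k >]) k.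

Lemma cr_le (d : nat) (v : 'I_d.+1 -> 'cV[int]_d) : (cr v <= d)%N.
Proof.
rewrite /cr /elementary_divisors.
case: int_Smith_normal_form => L _ [S _ [s _ _]].
by rewrite (leq_trans (count_size _ _)) // size_map size_iota.
Qed.

Definition std_vertex (d : nat) (i : 'I_d.+1) : 'cV[int]_d :=
  if unlift ord0 i is Some j then delta_mx j 0 else 0.

Lemma std_vertex_sum (R : realType) (d : nat) (a : 'I_d.+1 -> R) (j : 'I_d) :
  (\sum_i a i *: real_point R (std_vertex i)) j 0 = a (lift ord0 j).
Proof.
rewrite big_ord_recl /std_vertex unlift_none /real_point map_mx0 scaler0 add0r.
rewrite summxE (bigD1 j) //= big1 ?addr0 => [|k kj].
  by rewrite liftK !mxE !eqxx mulr1.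
by rewrite liftK !mxE eq_sym (negPf kj) mulr0.
Qed.

Lemma std_simplex (R : realType) (d : nat) : lattice_simplex R (@std_vertex d).
Proof.
move=> a a1 a0.
have al j : a (lift ord0 j) = 0 by rewrite -std_vertex_sum a0 mxE.
move=> i; case: (unliftP ord0 i) => [j ->|->]; first exact: al.
by move: a1; rewrite big_ord_recl big1 ?addr0.
Qed.

Lemma std_empty (R : realType) (d : nat) : empty_simplex R (@std_vertex d).
Proof.
move=> z [a [a_ge0 a1 zE]].
have zj j : (z j 0)%:~R = a (lift ord0 j).
  by rewrite -std_vertex_sum -zE mxE.
have z_ge0 j : 0 <= z j 0 by rewrite -(ler0z R) zj.
have [|/existsNP[j /eqP zj0]] := pselect (forall j, z j 0 = 0).
  move=> z0; exists ord0; apply/colP => j.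
  by rewrite /std_vertex unlift_none z0 mxE.
have zj1 : 1 <= z j 0 by rewrite -gtz0_ge1 lt_def zj0 z_ge0.
have S1 : \sum_(k | k != j) z k 0 <= 1 - z j 0.
  have -> : \sum_(k | k != j) z k 0 = \sum_k z k 0 - z j 0.
    by rewrite [\sum_k z k 0](bigD1 j) //= addrAC subrr add0r.
  rewrite lerD2r -(ler_int R) rmorph_sum /=.
  under eq_bigr do rewrite zj.
  by rewrite -a1 big_ord_recl lerDr.
have S0 : 0 <= \sum_(k | k != j) z k 0 by apply: sumr_ge0.
have zj_eq1 : z j 0 = 1.
  by apply/le_anti; rewrite zj1 andbT -subr_ge0 (le_trans S0).
have /eqP : \sum_(k | k != j) z k 0 = 0.
  by apply/le_anti; rewrite S0 andbT (le_trans S1) // zj_eq1 subrr.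
rewrite psumr_eq0 // => /allP zk0.
exists (lift ord0 j); apply/colP => k; rewrite /std_vertex liftK mxE eqxx andbT.
have [->//|kj] := eqVneq k j.
by have := zk0 k (mem_index_enum _); rewrite kj /= => /eqP.
Qed.

Lemma std_p_power (p d : nat) : p_power_simplex p (@std_vertex d).
Proof.
exists 0%N, (\0 : {additive simplex_group (@std_vertex d) -> 'rV['Z_p]_0}).
have A1 : simplex_mx (@std_vertex d) = 1%:M.
  apply/matrixP => i j.
  by rewrite mxE /std_vertex liftK unlift_none !mxE subr0 andbT.
have A1y (y : 'cV_d) : y = simplex_mx (@std_vertex d) *m y.
  by rewrite A1 mul1mx.
have G0 (x : simplex_group (@std_vertex d)) : x = 0.
  rewrite -[x]reprK -[0]reprK; apply/eqmodP; apply/asboolP.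
  by eexists; apply: A1y.
by exists (fun=> 0) => x; [rewrite [x]G0 | apply/rowP => -[]].
Qed.

Lemma crpP (R : realType) (p d : nat) :
  cr_value R p d (crp R p d) /\
  (forall k, cr_value R p d k -> (k <= crp R p d)%N).
Proof.
have cr_bnd k : cr_value R p d k -> (k < d.+1)%N.
  by case=> v [_ _ _ <-]; rewrite ltnS cr_le.
split=> [|k Hk]; last first.
  have := @leq_bigmax_cond _ (fun k : 'I_d.+1 => `[< cr_value R p d k >])
    (@nat_of_ord _) (Ordinal (cr_bnd k Hk)).
  by apply; apply/asboolP.
have H0 : cr_value R p d (cr (@std_vertex d)).
  by exists (@std_vertex d); split=> //;
    [apply: std_simplex | apply: std_empty | apply: std_p_power].
have [|k /asboolP kP kE] := @eq_bigmax_cond _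
    (fun k : 'I_d.+1 => `[< cr_value R p d k >]) (@nat_of_ord _).
  apply/card_gt0P; exists (Ordinal (cr_bnd _ H0)).
  by rewrite unfold_in; apply/asboolP.
by rewrite /crp kE.
Qed.

(* Main.v *)
Require Import Defs.
From HB Require Import structures.
From mathcomp Require Import all_boot all_order all_algebra.
From mathcomp Require Import boolp reals zify ring.

(** If 2 annihilates the group of the simplex with vertices [v], every lattice
    point has barycentric coordinates in (1/2)Z, so the simplex is empty iff no
    midpoint of two distinct vertices is a lattice point. Modulo 2, the doubled
    coordinates along the edges from [v ord0] form a binary code of length d and
    dimension [cr v], and emptiness means minimum distance at least 3. The
    Hamming bound 2^cr (d + 1) <= 2^d is the upper bound; a shortened Hamming
    code, whose parity-check matrix (1 H) has d distinct nonzero columns of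
    length r = floor(log2 d) + 1, is realised by the integer matrix with blocks
    (1, H; 0, 2) and gives the lower bound. *)

Set Implicit Arguments.
Unset Strict Implicit.
Unset Printing Implicit Defensive.

Import Order.TTheory GRing.Theory Num.Theory.
Local Open Scope quotient_scope.
Local Open Scope ring_scope.

(** * Reduction modulo 2 *)

Definition red2 (m n : nat) (A : 'M[int]_(m, n)) : 'M['Z_2]_(m, n) :=
  map_mx intr A.

Lemma pchar_Z2 : 2%N \in [pchar 'Z_2].
Proof. by rewrite inE /= -(inj_eq val_inj). Qed.

Lemma red2M (m n p : nat) (A : 'M[int]_(m, n)) (B : 'M[int]_(n, p)) :
  red2 (A *m B) = red2 A *m red2 B.
Proof. exact: map_mxM. Qed.

Lemma red2D (m n : nat) (A B : 'M[int]_(m, n)) :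
  red2 (A + B) = red2 A + red2 B.
Proof. exact: map_mxD. Qed.

Lemma red2B (m n : nat) (A B : 'M[int]_(m, n)) :
  red2 (A - B) = red2 A - red2 B.
Proof. exact: map_mxB. Qed.

Lemma Z2_addrr (m n : nat) (x : 'M['Z_2]_(m, n)) : x + x = 0.
Proof. by apply/matrixP => i j; rewrite !mxE (addrr_pchar2 pchar_Z2). Qed.

Lemma Z2_addr_eq0 (m n : nat) (x y : 'M['Z_2]_(m, n)) : x + y = 0 -> x = y.
Proof. by move/(congr1 (+%R^~ y)); rewrite -addrA Z2_addrr addr0 add0r. Qed.

Lemma Z2_subr (m n : nat) (x y : 'M['Z_2]_(m, n)) : x - y = x + y.
Proof. by congr (_ + _); apply/eqP; rewrite eq_sym -addr_eq0 Z2_addrr. Qed.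

Lemma red2_mul2 (m n : nat) (A : 'M[int]_(m, n)) : red2 (A *+ 2) = 0.
Proof. by rewrite mulr2n red2D Z2_addrr. Qed.

Lemma red2_eq0 (m n : nat) (A : 'M[int]_(m, n)) :
  red2 A = 0 -> exists B, A = B *+ 2.
Proof.
move=> /matrixP A0; exists (\matrix_(i, j) (A i j %/ 2)%Z).
apply/matrixP => i j; have := A0 i j; rewrite /red2 mxE [in RHS]mxE => /eqP.
rewrite -(dvdz_pcharf pchar_Z2) => /divzK.
by rewrite mulr2n !mxE => ?; lia.
Qed.

Lemma red2_surj (m n : nat) (M : 'M['Z_2]_(m, n)) :
  red2 (\matrix_(i, j) (M i j : nat)%:Z) = M.
Proof. by apply/matrixP => i j; rewrite !mxE -pmulrn natr_Zp. Qed.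

Lemma mulr2n_mx_inj (m n : nat) (x y : 'M[int]_(m, n)) :
  x *+ 2 = y *+ 2 -> x = y.
Proof.
move=> /matrixP xy; apply/matrixP => i j; have := xy i j.
by rewrite !mulr2n !mxE -!mulr2n => /(@pmulrnI _ 2 isT).
Qed.

(** * Simplices whose group has exponent 2 *)

Lemma simplex_mxM (d : nat) (v : 'I_d.+1 -> 'cV[int]_d) (y : 'cV[int]_d) :
  simplex_mx v *m y = \sum_j y j 0 *: (v (lift ord0 j) - v ord0).
Proof.
apply/colP => i; rewrite !mxE summxE; apply: eq_bigr => j _.
by rewrite !mxE mulrC.
Qed.

Lemma simplex_mx_std (d : nat) (v : 'I_d.+1 -> 'cV[int]_d) (i : 'I_d.+1) :
  simplex_mx v *m std_vertex i = v i - v ord0.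
Proof.
rewrite /std_vertex; case: unliftP => [j|] ->; last by rewrite mulmx0 subrr.
by apply/colP => k; rewrite -colE !mxE.
Qed.

(** That is, 2 annihilates the cokernel of [A]. *)
Definition two_torsion (d : nat) (A : 'M[int]_d) : Prop :=
  forall z : 'cV[int]_d, exists y, z *+ 2 = A *m y.

Lemma p_power_two_torsion (d : nat) (v : 'I_d.+1 -> 'cV[int]_d) :
  p_power_simplex 2 v -> two_torsion (simplex_mx v).
Proof.
move=> [s [f /bij_inj f_inj]] z.
set q := \pi_(simplex_group v) z.
have q2 : q + q = 0 by apply: f_inj; rewrite raddfD raddf0 Z2_addrr.
have : \pi_(simplex_group v) (z *+ 2) = \pi_(simplex_group v) 0.
  by rewrite mulr2n raddfD raddf0.
move=> /eqP; rewrite -Quotient.idealrBE subr0.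
by move=> /asboolP [y ->]; exists y.
Qed.

Lemma real_point_mul2 (R : realType) (d : nat) (x : 'cV[int]_d) :
  real_point R (x *+ 2) = 2 *: real_point R x.
Proof. by rewrite [in LHS]mulr2n /real_point map_mxD scaler_nat mulr2n. Qed.

Lemma real_point_sum (R : realType) (d n : nat) (w : 'I_n -> int)
    (v : 'I_n -> 'cV[int]_d) :
  real_point R (\sum_i w i *: v i) = \sum_i (w i)%:~R *: real_point R (v i).
Proof.
apply/colP => k; rewrite mxE !summxE rmorph_sum; apply: eq_bigr => i _.
by rewrite !mxE rmorphM.
Qed.

Definition midpoint_free (d : nat) (v : 'I_d.+1 -> 'cV[int]_d) : Prop :=
  forall z i j, z *+ 2 = v i + v j -> i = j.

Lemma sum_delta (V : lmodType int) (n : nat) (i : 'I_n) (v : 'I_n -> V) :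
  \sum_k (k == i)%:Z *: v k = v i.
Proof.
rewrite (bigD1 i) //= eqxx scale1r big1 ?addr0 // => k /negPf ->.
by rewrite scale0r.
Qed.

Lemma sum_delta1 (n : nat) (i : 'I_n) : \sum_k (k == i)%:Z = 1.
Proof.
rewrite (bigD1 i) //= eqxx big1 ?addr0 // => k /negPf ->; exact: erefl.
Qed.

Section Emptiness.
Variables (R : realType) (d : nat) (v : 'I_d.+1 -> 'cV[int]_d).
Hypothesis v_simplex : lattice_simplex R v.

(** By emptiness a lattice midpoint is itself a vertex, and by uniqueness of barycentric coordinates
    the coordinates 1/2, 1/2 of a proper midpoint are not those of a vertex. *)
Lemma empty_midpoint_free : empty_simplex R v -> midpoint_free v.
Proof.
move=> v_empty z i j zE.
pose w k : int := (k == i)%:Z + (k == j)%:Z.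
have w2 : \sum_k w k = 2 by rewrite big_split /= !sum_delta1.
have wv : \sum_k w k *: v k = z *+ 2.
  by under eq_bigr do rewrite scalerDl; rewrite big_split /= !sum_delta.
have [|k zk] := v_empty z.
  exists (fun k => (w k)%:~R / 2); split.
  - by move=> k; rewrite divr_ge0 // ler0z.
  - by rewrite -mulr_suml -(rmorph_sum intr) w2 divff // pnatr_eq0.
  - under eq_bigr do rewrite mulrC -scalerA.
    rewrite -scaler_sumr -real_point_sum wv real_point_mul2.
    by rewrite scalerA mulVf ?scale1r // pnatr_eq0.
pose a k0 : int := w k0 - (k0 == k)%:Z *+ 2.
have a0 : forall k0, (a k0)%:~R = 0 :> R.
  apply: v_simplex.
    rewrite -(rmorph_sum intr) sumrB w2 sumrMnl sum_delta1.
    by rewrite subrr.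
  rewrite -real_point_sum; under eq_bigr do rewrite scalerBl.
  rewrite sumrB wv; under [X in _ - X]eq_bigr do rewrite -scalerMnl.
  rewrite sumrMnl sum_delta zk subrr; exact: map_mx0.
have {a0} : a i = 0 by apply/eqP; rewrite -(intr_eq0 R) a0.
(* The value [a i] is 1 + [i = j] - 2[i = k], so its vanishing forces i = j by parity. *)
by rewrite /a /w eqxx; case: (i =P j) => //; case: (i == k).
Qed.

(** Torsion makes the doubled barycentric coordinates of a lattice point integers; being
    non-negative with sum 2, they exhibit it as the midpoint of two vertices, which then
    coincide. *)
Lemma two_torsion_empty :
  two_torsion (simplex_mx v) -> midpoint_free v -> empty_simplex R v.
Proof.
move=> tors mid z [a [a_ge0 a1 zE]].
have [y yE] := tors (z - v ord0).
(* The coordinates [y] weight the vertices other than [v ord0], whose own weight is chosen to make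
   the total 2. *)
pose w k : int := if unlift ord0 k is Some j then y j 0 else 2 - \sum_j y j 0.
have w2 : \sum_k w k = 2.
  rewrite big_ord_recl /w unlift_none.
  by under [X in _ + X]eq_bigr do rewrite liftK; rewrite subrK.
have wv : \sum_k w k *: v k = z *+ 2.
  rewrite big_ord_recl /w unlift_none.
  under [X in _ + X]eq_bigr do rewrite liftK.
  rewrite -[z](subrK (v ord0)) mulrnDl yE simplex_mxM.
  under [in RHS]eq_bigr do rewrite scalerBr.
  by rewrite sumrB -scaler_suml scalerBl scaler_nat addrC addrA addrAC.
(* Affine independence identifies the integer weights with the doubled real ones, which gives their
   sign. *)
have wa k : (w k)%:~R = 2 * a k.
  apply/eqP; rewrite -subr_eq0; apply/eqP; move: k; apply: v_simplex.
    by rewrite sumrB -(rmorph_sum intr) w2 -mulr_sumr a1 mulr1 subrr.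
  under eq_bigr do rewrite scalerBl -scalerA.
  rewrite sumrB -real_point_sum -scaler_sumr -zE wv.
  by rewrite real_point_mul2 subrr.
have w_ge0 k : 0 <= w k by rewrite -(ler0z R) wa mulr_ge0.
(* Non-negative integer weights of total 2 single out two (maybe equal) vertices. *)
have [i wi] : exists i, 0 < w i.
  apply/not_existsP => w0; have : \sum_k w k <= 0.
    by apply: sumr_le0 => k _; rewrite leNgt; apply/negP.
  by rewrite w2.
pose w' k := w k - (k == i)%:Z.
have w'1 : \sum_k w' k = 1 by rewrite sumrB w2 sum_delta1.
have w'_ge0 k : 0 <= w' k.
  rewrite /w'; case: eqVneq => [->|_] /=; last by rewrite subr0.
  by rewrite subr_ge0 -gtz0_ge1.
have [j wj] : exists j, 0 < w' j.
  apply/not_existsP => w0; have : \sum_k w' k <= 0.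
    by apply: sumr_le0 => k _; rewrite leNgt; apply/negP.
  by rewrite w'1.
have w'E k : w' k = (k == j)%:Z.
  have wk_ge0 l : 0 <= w' l - (l == j)%:Z.
    case: eqVneq => [->|_] /=; last by rewrite subr0.
    by rewrite subr_ge0 -gtz0_ge1.
  have /eqP : \sum_k (w' k - (k == j)%:Z) = 0 by rewrite sumrB w'1 sum_delta1.
  rewrite psumr_eq0 // => /allP /(_ k (mem_index_enum _)) /=.
  by rewrite subr_eq0 => /eqP.
have zij : z *+ 2 = v i + v j.
  rewrite -wv -(sum_delta i v) -(sum_delta j v) -big_split /=.
  apply: eq_bigr => k _; rewrite -scalerDl -w'E; congr (_ *: _).
  by rewrite /w' addrC subrK.
exists i; apply: mulr2n_mx_inj; rewrite zij.
by rewrite -(mid _ _ _ zij) mulr2n.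
Qed.

End Emptiness.

(** * Elementary divisors *)

Lemma cr_smith (d : nat) (v : 'I_d.+1 -> 'cV[int]_d) :
  exists (L U : 'M[int]_d) (s : 'rV[int]_d),
    [/\ L \in unitmx, U \in unitmx, simplex_mx v = L *m diag_mx s *m U
      & cr v = #|[set i | (1 < absz (s 0%R i))%N]|].
Proof.
rewrite /cr /elementary_divisors.
case: int_Smith_normal_form => L uL [U uU [s _ AE]].
exists L, U, (\row_i s`_i); split=> //.
  rewrite AE; congr (_ *m _ *m _); apply/matrixP => i j.
  by rewrite !mxE.
rewrite count_map -val_enum_ord count_map cardsE cardE size_filter enumT.
by apply: eq_count => i; rewrite /= unfold_in mxE.
Qed.

(** For z = L e_i, cancelling [L] leaves 2 e_i = diag(s) U y, whose i-th entry factors 2 through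
    s_i. *)
Lemma two_torsion_divisor (d : nat) (L U : 'M[int]_d) (s : 'rV[int]_d) :
  L \in unitmx -> two_torsion (L *m diag_mx s *m U) ->
  forall i, (absz (s 0%R i) %| 2)%N.
Proof.
move=> uL tors i; have [y] := tors (L *m delta_mx i 0).
rewrite -mulmxA -mulmxA -raddfMn /= => /(can_inj (mulKmx uL)) /colP /(_ i).
rewrite mulr2n mul_diag_mx !mxE !eqxx /= => e.
by apply/dvdnP; exists (absz (\sum_j U i j * y j 0)); rewrite mulnC -abszM -e.
Qed.

Lemma dvdn2_gt1 (n : nat) : (n %| 2)%N -> n = if (1 < n)%N then 2%N else 1%N.
Proof. by case: n => [|[|[|n]]] // /dvdn_leq; move/(_ isT). Qed.

Lemma absz_det_unit (d : nat) (L : 'M[int]_d) :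
  L \in unitmx -> absz (\det L) = 1%N.
Proof. by rewrite unitmxE qualifE /= => /orP[] /eqP ->. Qed.

(** Up to sign each diagonal entry is 1 or 2, and [cr] counts the 2s. This lets [cr] be read off a
    determinant, with no Smith form to compute. *)
Lemma two_torsion_det (d : nat) (v : 'I_d.+1 -> 'cV[int]_d) :
  two_torsion (simplex_mx v) -> absz (\det (simplex_mx v)) = (2 ^ cr v)%N.
Proof.
have [L [U [s [uL uU -> ->]]]] := cr_smith v.
move=> /(two_torsion_divisor uL) s2.
rewrite !det_mulmx !abszM (absz_det_unit uL) (absz_det_unit uU) mul1n muln1 det_diag.
rewrite (big_morph absz abszM (erefl : absz 1 = 1%N)) -prod_nat_const.
rewrite [RHS]big_mkcond; apply: eq_bigr => i _.
by rewrite [LHS]dvdn2_gt1 // inE.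
Qed.

(* Sphere packing: over F_2 the solutions w of "A w even" form a code of
   dimension [cr v], and midpoint-freeness says that the translates of this
   code by the d + 1 vectors 0, e_1, ..., e_d are pairwise disjoint. *)
Lemma midpoint_free_hamming (d : nat) (v : 'I_d.+1 -> 'cV[int]_d) :
  two_torsion (simplex_mx v) -> midpoint_free v ->
  (2 ^ cr v * d.+1 <= 2 ^ d)%N.
Proof.
have [L [U [s [uL uU AE ->]]]] := cr_smith v.
move=> tors mid; set S := [set i | _].
have s2 i : i \in S -> absz (s 0%R i) = 2%N.
  move: tors; rewrite AE => /(two_torsion_divisor uL)/(_ i)/dvdn2_gt1.
  by rewrite inE => + gt1; rewrite gt1.
pose ind (T : {set 'I_d}) : 'cV[int]_d := \col_i (i \in T)%:Z.
have even (T : {set 'I_d}) : T \subset S ->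
    exists z, simplex_mx v *m (invmx U *m ind T) = z *+ 2.
  (* On [S] the entries of [s] are 2 or -2, so [diag_mx s] doubles the indicator of [T] up to the
     signs recorded by [sgz]. *)
  move=> /subsetP TS; exists (L *m \col_i (sgz (s 0 i) * (i \in T)%:Z)).
  rewrite AE -mulmxA mulKVmx // -mulmxA -raddfMn /=; congr (_ *m _).
  apply/colP => i; rewrite mul_diag_mx mulr2n !mxE -mulr2n.
  case: (i \in T) (TS i) => [/(_ isT)/s2 si|_]; last by rewrite !mulr0.
  by rewrite {1}[s 0 i]intEsg si !mulr1; move: (sgz _) => a; lia.
(* The codeword indexed by [T], translated by a vertex of the standard simplex, modulo 2. *)
pose F (p : {set 'I_d} * 'I_d.+1) :=
  red2 (invmx U *m ind p.1 + std_vertex p.2).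
have F_inj : {in setX (powerset S) [set: 'I_d.+1] &, injective F}.
  move=> [T i] [T' j]; rewrite !inE /= !andbT /F /= => /even[z zE] /even[z' zE'].
  move=> FE; have ij : i = j.
    have /red2_eq0[u uE] : red2 ((invmx U *m ind T - invmx U *m ind T')
                                 + (std_vertex i + std_vertex j)) = 0.
      rewrite red2D red2B red2D Z2_subr addrACA.
      rewrite -[_ + red2 (std_vertex i)]red2D FE.
      by rewrite -[_ + red2 (std_vertex j)]red2D Z2_addrr.
    have := congr1 (mulmx (simplex_mx v)) uE.
    rewrite mulmxDr mulmxBr mulmxDr zE zE' !simplex_mx_std (raddfMn (mulmx (simplex_mx v))) /=.
    (* With A = [simplex_mx v], [e] reads 2z - 2z' + v_i + v_j - 2v_0 = 2Au, so this point is the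
       midpoint of [v i] and [v j]. *)
    move=> e; apply: (mid (simplex_mx v *m u - z + z' + v ord0)).
    rewrite !mulrnDl mulNrn -e; move: (z *+ 2) (z' *+ 2) => a b.
    by apply/colP => k; rewrite mulr2n !mxE; ring.
  (* Equal translations cancel, and multiplying by [U] recovers the two indicators. *)
  move: FE; rewrite ij !red2D => /addIr FE; congr (_, _).
  have := congr1 (mulmx (red2 U)) FE; rewrite -!red2M !mulKVmx //.
  move=> /colP TT'; apply/setP => k; have := TT' k; rewrite !mxE.
  by case: (k \in T); case: (k \in T') => // /(congr1 val).
have := @leq_card_in _ 'cV['Z_2]_d F _ F_inj.
by rewrite cardsX cardsT card_powerset card_ord card_mx card_ord muln1.
Qed.

(** * Simplices from parity-check matrices *)

Lemma lattice_simplex_mul_std (R : realType) (d : nat) (A : 'M[int]_d) :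
  \det A != 0 -> lattice_simplex R (fun i => A *m std_vertex i).
Proof.
move=> detA a a1 a0; apply: (@std_simplex R d) => //.
have uA : (map_mx intr A : 'M[R]_d) \in unitmx.
  by rewrite unitmxE det_map_mx unitfE intr_eq0.
apply: (can_inj (mulKmx uA)); rewrite mulmx0 -[RHS]a0 mulmx_sumr.
by apply: eq_bigr => i _; rewrite /real_point map_mxM scalemxAr.
Qed.

Lemma simplex_mx_mul_std (d : nat) (A : 'M[int]_d) :
  simplex_mx (fun i => A *m std_vertex i) = A.
Proof.
apply/matrixP => i j; rewrite mxE /std_vertex liftK unlift_none.
by rewrite mulmx0 subr0 -colE mxE.
Qed.

(** First isomorphism theorem: [g] is onto with kernel the image lattice, so it induces a bijection
    on the quotient. *)
Lemma p_power_simplex_morphism (p d s : nat) (v : 'I_d.+1 -> 'cV[int]_d)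
    (g : {additive 'cV[int]_d -> 'rV['Z_p]_s}) :
  (forall y, exists x, g x = y) ->
  (forall x, g x = 0 <-> exists y, x = simplex_mx v *m y) ->
  p_power_simplex p v.
Proof.
move=> g_surj gK.
pose f (q : simplex_group v) := g (repr q).
have fE x : f (\pi_(simplex_group v) x) = g x.
  apply/eqP; rewrite -subr_eq0 -raddfB; apply/eqP/gK/asboolP.
  have : repr (\pi_(simplex_group v) x) - x \in image_lattice (simplex_mx v).
    by rewrite Quotient.idealrBE reprK.
  by [].
have fB : zmod_morphism f.
  by move=> x y; rewrite -[x]reprK -[y]reprK -raddfB !fE raddfB.
pose fM := GRing.isZmodMorphism.Build _ _ f fB.
pose fA : {additive simplex_group v -> 'rV['Z_p]_s} := HB.pack f fM.
exists s, fA.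
have [h hK] := choice g_surj.
exists (fun y => \pi_(simplex_group v) (h y)) => [q|y]; last first.
  by rewrite /= fE hK.
rewrite -[RHS]reprK; apply/eqP; rewrite -Quotient.idealrBE.
by apply/asboolP/gK; rewrite raddfB hK subrr.
Qed.

Section ParityCheck.
Variables (r m : nat) (H : 'M['Z_2]_(r, m)).

Definition check_lift : 'M[int]_(r, m) := \matrix_(i, j) (H i j : nat)%:Z.

(** Whatever [H] is, the image lattice consists of all (x, y) with y even, so the group is (Z/2)^m;
    [H] governs the position of the vertices. *)
Definition check_mx : 'M[int]_(r + m) :=
  block_mx 1%:M check_lift 0 2%:M.

Definition check_simplex (i : 'I_(r + m).+1) : 'cV[int]_(r + m) :=
  check_mx *m std_vertex i.

Lemma det_check_mx : \det check_mx = 2 ^+ m.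
Proof. by rewrite det_ublock det1 mul1r det_scalar. Qed.

Lemma check_p_power : p_power_simplex 2 check_simplex.
Proof.
pose g (x : 'cV[int]_(r + m)) := (red2 (dsubmx x))^T.
have gB : zmod_morphism g.
  by move=> x y; rewrite /g !raddfB /= red2B raddfB.
pose gM := GRing.isZmodMorphism.Build _ _ g gB.
pose gA : {additive 'cV[int]_(r + m) -> 'rV['Z_2]_m} := HB.pack g gM.
apply: (@p_power_simplex_morphism _ _ _ _ gA) => [y|x].
  exists (col_mx 0 (\matrix_(i, j) (y^T i j : nat)%:Z)).
  by rewrite /= /g col_mxKd red2_surj trmxK.
rewrite simplex_mx_mul_std /=; split=> [|[y ->]].
  move=> /(congr1 trmx); rewrite trmxK trmx0 => /red2_eq0[u uE].
  exists (col_mx (usubmx x - check_lift *m u) u).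
  rewrite mul_block_col mul1mx subrK mul0mx add0r mul_scalar_mx.
  by rewrite scaler_nat -uE vsubmxK.
rewrite /g -[y]vsubmxK mul_block_col col_mxKd mul0mx add0r mul_scalar_mx.
by rewrite scaler_nat red2_mul2 trmx0.
Qed.

Lemma cr_check_simplex : cr check_simplex = m.
Proof.
have := two_torsion_det (p_power_two_torsion check_p_power).
rewrite simplex_mx_mul_std det_check_mx abszX => /eqP.
by rewrite eqn_exp2l // => /eqP.
Qed.

(** Modulo 2 the top [r] rows of [check_mx] form (1 H), so two vertices with even sum have equal
    syndromes. *)
Lemma check_midpoint_free :
  injective (fun i : 'I_(r + m).+1 => row_mx 1%:M H *m red2 (std_vertex i)) ->
  midpoint_free check_simplex.
Proof.
move=> H_inj z i j; rewrite /check_simplex -mulmxDr => zE; apply: H_inj.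
apply: Z2_addr_eq0; rewrite -mulmxDr -red2D.
have := congr1 (fun x => usubmx (red2 x)) zE.
rewrite red2_mul2 red2M [red2 check_mx]map_block_mx -/(red2 check_lift).
by rewrite red2_surj map_mx1 mul_col_mx col_mxKu raddf0 => <-.
Qed.

End ParityCheck.

(** Of the 2^r vectors, 0 and the unit vectors take up r + 1; at least m remain to serve as distinct
    columns of [H]. *)
Lemma parity_check_mx_exists (r m : nat) : (r + m < 2 ^ r)%N ->
  exists H : 'M['Z_2]_(r, m),
    injective (fun i : 'I_(r + m).+1 => row_mx 1%:M H *m red2 (std_vertex i)).
Proof.
move=> lt_rm; pose g (i : 'I_r.+1) : 'cV['Z_2]_r := red2 (std_vertex i).
have gl i : g (lift ord0 i) = delta_mx i 0.
  by rewrite /g /std_vertex liftK; exact: map_delta_mx.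
have g0 : g ord0 = 0.
  by rewrite /g /std_vertex unlift_none; exact: map_mx0.
have g_inj : injective g.
  have delta_n0 k : delta_mx k 0 <> 0 :> 'cV['Z_2]_r.
    by move/colP/(_ k); rewrite !mxE !eqxx.
  move=> i j; case: (unliftP ord0 i) => [i'|] ->;
    case: (unliftP ord0 j) => [j'|] ->; rewrite ?gl ?g0 //.
  - move=> /colP/(_ i'); rewrite !mxE !eqxx /=.
    by case: (i' =P j') => [->|].
  - by move/delta_n0.
  - by move/esym/delta_n0.
pose S := ~: (g @: setT).
have mS : (m <= #|S|)%N.
  have := cardsC (g @: setT); rewrite -/S card_imset // cardsT card_ord.
  rewrite card_mx card_ord muln1 => cS.
  by rewrite -(leq_add2l r.+1) cS addSn.
pose c (b : 'I_m) : 'cV['Z_2]_r := enum_val (widen_ord mS b).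
exists (\matrix_(i, j) c j i 0); set h := fun i => _.
(* Position of 0 and of the identity block's columns among the r + m + 1 indices. *)
pose phi (a : 'I_r.+1) : 'I_(r + m).+1 :=
  if unlift ord0 a is Some a' then lift ord0 (lshift m a') else ord0.
have hP i : (exists a, i = phi a /\ h i = g a) \/
            (exists b, i = lift ord0 (rshift r b) /\ h i = c b).
  case: (unliftP ord0 i) => [i'|] ->; last first.
    left; exists ord0; rewrite /phi /h /std_vertex !unlift_none g0.
    by rewrite /red2 map_mx0 mulmx0.
  have hl : h (lift ord0 i') = col i' (row_mx 1%:M (\matrix_(i, j) c j i 0)).
    by rewrite /h /std_vertex liftK /red2 map_delta_mx colE.
  case: (splitP i') => k ik.
    have i'E : i' = lshift m k by apply: val_inj.
    left; exists (lift ord0 k); rewrite /phi liftK gl; split; first by rewrite i'E.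
    by rewrite hl i'E colKl; apply/colP => l; rewrite !mxE eqxx andbT.
  have i'E : i' = rshift r k by apply: val_inj.
  right; exists k; split; first by rewrite i'E.
  by rewrite hl i'E colKr; apply/colP => l; rewrite !mxE.
have cN b a : c b <> g a.
  move=> e; have := enum_valP (widen_ord mS b).
  by rewrite -/(c b) e !inE imset_f ?inE.
move=> i j.
case: (hP i) => [[a [-> ->]]|[b [-> ->]]];
  case: (hP j) => [[a' [-> ->]]|[b' [-> ->]]].
- by move/g_inj => ->.
- by move/esym/cN.
- by move/cN.
- by move=> /enum_val_inj/(congr1 val)/= /val_inj ->.
Qed.

Lemma cr_value_hamming (R : realType) (r m : nat) :
  (r + m < 2 ^ r)%N -> cr_value R 2 (r + m) m.
Proof.
move=> /parity_check_mx_exists[H H_inj]; exists (check_simplex H).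
have simp : lattice_simplex R (check_simplex H).
  by apply: lattice_simplex_mul_std; rewrite det_check_mx expf_neq0.
have pp := check_p_power H; split=> //; last exact: cr_check_simplex.
apply: two_torsion_empty => //; first exact: p_power_two_torsion.
exact: check_midpoint_free.
Qed.

Theorem theorem4p5 (R : realType) (d : nat) (hd : (3 <= d)%N) :
  crp R 2 d = (d - trunc_log 2 d - 1)%N.
Proof.
have d_gt0 : (0 < d)%N by apply: leq_trans hd.
have [] := crpP R 2 d; set k := crp R 2 d; set t := trunc_log 2 d.
move=> [v [simp emp pp kE]] k_max; apply/eqP; rewrite eqn_leq; apply/andP; split.
  have := midpoint_free_hamming (p_power_two_torsion pp)
    (empty_midpoint_free simp emp).
  rewrite kE => packing.
  (* From 2^t <= d < d + 1 the packing bound becomes strict, hence k + t < d; this accounts for the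
     final - 1. *)
  have : (2 ^ (k + t) < 2 ^ d)%N.
    rewrite expnD; apply: leq_trans packing.
    by rewrite ltn_pmul2l ?expn_gt0 // ltnS trunc_logP.
  by rewrite ltn_exp2l //; lia.
have td : (t < d)%N by apply: leq_trans (ltn_expl t _) (trunc_logP _ d_gt0).
(* Here r = t + 1 is the least r with d < 2^r, and t < d keeps the truncated subtraction exact. *)
apply: k_max; have dE : (t.+1 + (d - t - 1) = d)%N by lia.
rewrite -[X in cr_value R 2 X]dE; apply: cr_value_hamming.
by rewrite dE; exact: trunc_log_ltn.
Qed.
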